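(* Let $h\in\mathbb{F}[x]$ with $\deg h\ge1$ and $\mathcal{A}=\mathrm{Aut}_{\mathbb{F}}(A_h)$. The center of $\mathcal{A}$ is $Z(\mathcal{A})=\{\phi_r: r\in D_Z\}$, where $D_Z=\{r\in\mathbb{F}[x]: r(\zeta x+\varepsilon)=\zeta^{\deg h-1}r(x)\ \forall(\zeta,\varepsilon)\in\mathbb{P}\}$, and: (1) if $\mathcal{A}=\{\phi_f:f\in\mathbb{F}[x]\}$, then $D_Z=\mathbb{F}[x]$ and $Z(\mathcal{A})=\mathcal{A}$; (2) if $\tau_{\mathbb{P}}=\tau_{1,\mathbb{G}}$, then $D_Z=\mathbb{F}[t]$ with $t(x)=\prod_{\nu\in\mathbb{G}}(x+\nu)$; (3) if $\tau_{\mathbb{P}}\cong\mathbb{F}^*$ as in the case $h=\gamma(x-\lambda)^n$ with $\gamma\in\mathbb{F}^*$, $\lambda\in\mathbb{F}$, $n\ge1$, and $\mathbb{F}$ is infinite, then $D_Z=\mathbb{F}(x-\lambda)^{n-1}$; (4) if $\tau_{\mathbb{P}}=\tau_{1,\mathbb{G}}\rtimes\langle\tau_{\alpha,\beta}\rangle$ with $\alpha$ a primitive $\ell$-th root of unity for some $\ell>1$, then $D_Z=q\,\mathbb{F}[t]$ where $q(x)=\prod_{\nu\in\mathbb{G}}\left(x+\frac{\beta}{\alpha-1}+\nu\right)^{n}$, $t(x)=\prod_{\nu\in\mathbb{G}}\left(x+\frac{\beta}{\alpha-1}+\nu\right)^{\ell}$, and $0\le n<\ell$ is the integer with $n|\mathbb{G}|\equiv\deg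 h-1\pmod{\ell}$. In all cases $\{\phi_r: r\in\mathbb{F}h'\}\subseteq Z(\mathcal{A})$.
   Context: $\mathbb{F}$ is an arbitrary field. For $h\in\mathbb{F}[x]$, $A_h$ is the unital associative $\mathbb{F}$-algebra generated by $x,\hat y$ with defining relation $\hat yx-x\hat y=h$. Let $\mathbb{P}=\{(\alpha,\beta)\in\mathbb{F}^*\times\mathbb{F}: h(\alpha x+\beta)=\alpha^{\deg h}h(x)\}$; for $(\alpha,\beta)\in\mathbb{P}$, $\tau_{\alpha,\beta}$ is the automorphism of $A_h$ with $x\mapsto\alpha x+\beta$, $\hat y\mapsto\alpha^{\deg h-1}\hat y$; $\tau_{\mathbb{P}}=\{\tau_{\alpha,\beta}\}$. For $f\in\mathbb{F}[x]$, $\phi_f$ is the automorphism with $x\mapsto x$, $\hat y\mapsto\hat y+f$. It is known that $\mathcal{A}=\{\phi_f\}\rtimes\tau_{\mathbb{P}}$. $\mathbb{G}=\{\nu\in\mathbb{F}:(1,\nu)\in\mathbb{P}\}$ (finite additive subgroup) and $\tau_{1,\mathbb{G}}=\{\tau_{1,\nu}:\nu\in\mathbb{G}\}$. $h'$ is the formal derivative. *)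

(* Defs.v *)
From HB Require Import structures.
From mathcomp Require Import all_boot all_order all_algebra.
Set Implicit Arguments. Unset Strict Implicit. Unset Printing Implicit Defensive.
Import Order.TTheory GRing.Theory Num.Theory.
Local Open Scope ring_scope.

Section Ah.
Variable F : fieldType.

(* The algebra A_h is modelled by its PBW normal form: an element
   sum_j c_j(x) yhat^j  is the polynomial  sum_j c_j%:P * 'X^j : {poly {poly F}}
   (coefficients in F[x] written on the left of powers of yhat).
   Multiplication is the Ore-extension product for the derivation
   delta = h * d/dx, using  yhat^i g = sum_k C(i,k) delta^k(g) yhat^(i-k). *)

Definition hder (h g : {poly F}) : {poly F} := h * g^`().

Definition Ah_mul (h : {poly F}) (a b : {poly {poly F}}) : {poly {poly F}} :=
  \sum_(i < size a) \sum_(j < size b) \sum_(k < i.+1)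
    (((('C(i, k))%:R * a`_i * iter k (hder h) b`_j)%:P) * 'X^(i - k + j)).

Definition Ah_pow (h : {poly F}) (a : {poly {poly F}}) (n : nat) :=
  iter n (Ah_mul h a) 1.

Definition is_aut (h : {poly F}) (s : {poly {poly F}} -> {poly {poly F}}) : Prop :=
  [/\ bijective s,
      (forall a b, s (a + b) = s a + s b),
      (forall (c : F) a, s (c%:P%:P * a) = c%:P%:P * s a),
      s 1 = 1
    & (forall a b, s (Ah_mul h a b) = Ah_mul h (s a) (s b))].

Definition is_central_aut (h : {poly F}) (s : {poly {poly F}} -> {poly {poly F}}) : Prop :=
  is_aut h s /\ (forall t, is_aut h t -> (s \o t) =1 (t \o s)).

(* phi_f : x |-> x, yhat |-> yhat + f, extended multiplicatively *)
Definition phi (h f : {poly F}) (a : {poly {poly F}}) : {poly {poly F}} :=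
  \sum_(j < size a) Ah_mul h (a`_j)%:P (Ah_pow h ('X + f%:P) j).

Definition inP (h : {poly F}) (al be : F) : Prop :=
  al != 0 /\ h \Po (al *: 'X + be%:P) = al ^+ (size h).-1 *: h.

(* the set D_Z ; deg h - 1 = (size h).-2 *)
Definition inDZ (h r : {poly F}) : Prop :=
  forall z e, inP h z e -> r \Po (z *: 'X + e%:P) = z ^+ (size h).-2 *: r.

Definition enumG (h : {poly F}) (sG : seq F) : Prop :=
  uniq sG /\ forall nu, nu \in sG <-> inP h 1 nu.

End Ah.

(* Main.v *)
Require Import Defs.
From HB Require Import structures.
From mathcomp Require Import all_boot all_order all_algebra.
From mathcomp Require Import ring.
Import Order.TTheory GRing.Theory Num.Theory.
Local Open Scope ring_scope.

(* Left multiplication by yhat is the operator 'X * _ + h d/dx on normal forms,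
   which yields associativity and additivity of the yhat-degree.  Modulo h the
   product is commutative, so an automorphism s sends h = [yhat, x] into h A_h;
   applying this to the inverse as well, s h = c h with c a scalar.  Comparing
   yhat-degrees in h(s x) = c h gives s x in F[x], hence s x = al x + be with
   (al, be) in P, and then s yhat = al^(deg h - 1) yhat + f.  Comparing the two
   composites of s with such maps on x and yhat shows that s is central iff
   s = phi_f with f in D_Z.

   For D_Z itself: a polynomial r invariant under a finite translation group G
   takes the value r(0) on G, so r - r(0) is divisible by prod (x + nu), whence
   r lies in F[t] by induction on the degree.  In case (4) be / (al - 1) is minus
   the fixed point of al x + be; in the coordinate centred there the remaining
   condition selects the exponents congruent to deg h - 1 modulo l, because
   |G| = 1 mod l. *)

Set Implicit Arguments.
Unset Strict Implicit.
Unset Printing Implicit Defensive.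

Local Notation aff al be := (al *: 'X + be%:P).

(** * Associativity and biadditivity of the normal-form product *)

Section OreProduct.
Variables (F : fieldType) (h : {poly F}).
Implicit Types (a b : {poly {poly F}}) (c g u : {poly F}).

(** The derivation h d/dx acting on coefficients, with yhat held constant: the correction term when
    yhat moves to the right past a coefficient. *)
Definition coef_der b : {poly {poly F}} := h%:P * map_poly (@deriv F) b.

(* Left multiplication by yhat in A_h. *)
Definition ymul b : {poly {poly F}} := 'X * b + coef_der b.

Lemma coef_coef_der b j : (coef_der b)`_j = hder h b`_j.
Proof. by rewrite coefCM coef_map. Qed.

Lemma hder0 : hder h 0 = 0.
Proof. by rewrite /hder linear0 mulr0. Qed.

Lemma coef_der0 : coef_der 0 = 0.
Proof. by rewrite /coef_der raddf0 mulr0. Qed.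

Lemma coef_derD a b : coef_der (a + b) = coef_der a + coef_der b.
Proof. by rewrite /coef_der raddfD mulrDr. Qed.

Lemma coef_der_sum I r (P : pred I) (E : I -> {poly {poly F}}) :
  coef_der (\sum_(i <- r | P i) E i) = \sum_(i <- r | P i) coef_der (E i).
Proof. exact: (big_morph _ coef_derD coef_der0). Qed.

Lemma coef_derCM c b :
  coef_der (c%:P * b) = (hder h c)%:P * b + c%:P * coef_der b.
Proof.
apply/polyP => j; rewrite !(coefD, coef_coef_der, coefCM) /hder derivM.
by ring.
Qed.

Lemma coef_derXM b : coef_der ('X * b) = 'X * coef_der b.
Proof.
apply/polyP => j; rewrite coef_coef_der !coefXM coef_coef_der.
by case: eqP => // _; rewrite hder0.
Qed.

Lemma coef_derXnM n b : coef_der ('X^n * b) = 'X^n * coef_der b.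
Proof.
elim: n => [|n IHn]; first by rewrite expr0 !mul1r.
by rewrite exprS -!mulrA coef_derXM IHn.
Qed.

Lemma coef_der_natM n b : coef_der (n%:R * b) = n%:R * coef_der b.
Proof. by rewrite !mulr_natl /coef_der raddfMn mulrnAr. Qed.

Lemma coef_iter_coef_der k b j :
  (iter k coef_der b)`_j = iter k (hder h) b`_j.
Proof. by elim: k => //= k IHk; rewrite coef_coef_der IHk. Qed.

Lemma ymul0 : ymul 0 = 0.
Proof. by rewrite /ymul coef_der0 mulr0 addr0. Qed.

Lemma ymulD a b : ymul (a + b) = ymul a + ymul b.
Proof. by rewrite /ymul coef_derD mulrDr addrACA. Qed.

Lemma ymulCM c b : ymul (c%:P * b) = c%:P * ymul b + (hder h c)%:P * b.
Proof. by rewrite /ymul coef_derCM; ring. Qed.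

Lemma iter_ymul0 i : iter i ymul 0 = 0.
Proof. by elim: i => //= i ->; rewrite ymul0. Qed.

Lemma iter_ymulD i a b : iter i ymul (a + b) = iter i ymul a + iter i ymul b.
Proof. by elim: i => //= i ->; rewrite ymulD. Qed.

(** Multiplication by ['X] commutes with [coef_der], so the binomial theorem applies to powers of
    their sum. *)
Lemma iter_ymulE i b :
  iter i ymul b
    = \sum_(k < i.+1) ('C(i, k))%:R * 'X^(i - k) * iter k coef_der b.
Proof.
elim: i => [|i IHi]; first by rewrite big_ord1 /= bin0 expr0 !mul1r.
rewrite iterS IHi {IHi} /ymul coef_der_sum mulr_sumr.
have -> : \sum_(k < i.+1) 'X * ('C(i, k)%:R * 'X^(i - k) * iter k coef_der b)
  = \sum_(k < i.+2) 'C(i, k)%:R * 'X^(i.+1 - k) * iter k coef_der b.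
  rewrite [RHS]big_ord_recr /= bin_small // mul0r mul0r addr0.
  by apply: eq_bigr => k _; rewrite subSn ?leq_ord // exprS [in RHS]mulrCA -!mulrA.
rewrite big_ord_recl [RHS]big_ord_recl /= !bin0 -addrA; congr (_ + _).
rewrite -big_split /=; apply: eq_bigr => k _.
rewrite /bump /= !add1n subSS binS natrD -!mulrA coef_der_natM coef_derXnM.
by rewrite -mulrDl.
Qed.

(** Recognizes the inner two sums of [Ah_mul] as the action of yhat^i on [b]; the later arguments
    use this form instead of the triple sum. *)
Lemma Ah_mulE a b : Ah_mul h a b = \sum_(i < size a) (a`_i)%:P * iter i ymul b.
Proof.
apply: eq_bigr => i _; rewrite iter_ymulE mulr_sumr exchange_big /=.
apply: eq_bigr => k _.
have -> : iter k coef_der b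
    = \sum_(j < size b) (iter k (hder h) b`_j)%:P * 'X^j.
  under eq_bigr do rewrite mul_polyC.
  rewrite -(poly_def _ (fun j => iter k (hder h) b`_j)); apply/polyP => j.
  rewrite coef_poly coef_iter_coef_der; case: ltnP => // le_bj.
  by rewrite nth_default //; elim: (nat_of_ord k) => //= n ->; rewrite hder0.
rewrite !mulr_sumr; apply: eq_bigr => j _.
rewrite exprD !polyCM polyC_natr -!mulrA mulrCA; congr (_ * (_ * _)).
exact: mulrCA.
Qed.

Lemma Ah_mul_wide n a b : (size a <= n)%N ->
  Ah_mul h a b = \sum_(i < n) (a`_i)%:P * iter i ymul b.
Proof.
move=> le_an; rewrite Ah_mulE.
rewrite (big_ord_widen _ (fun i => (a`_i)%:P * iter i ymul b) le_an).
rewrite big_mkcond; apply: eq_bigr => i _; case: ltnP => // le_ai.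
by rewrite nth_default // polyC0 mul0r.
Qed.

Lemma Ah_mulDl a a' b : Ah_mul h (a + a') b = Ah_mul h a b + Ah_mul h a' b.
Proof.
pose n := maxn (size a) (size a').
rewrite !(@Ah_mul_wide n) ?leq_maxl ?leq_maxr //; last exact: size_polyD.
by rewrite -big_split /=; apply: eq_bigr => i _; rewrite coefD polyCD mulrDl.
Qed.

Lemma Ah_mulDr a b b' : Ah_mul h a (b + b') = Ah_mul h a b + Ah_mul h a b'.
Proof.
rewrite !Ah_mulE -big_split /=; apply: eq_bigr => i _.
by rewrite iter_ymulD mulrDr.
Qed.

Lemma Ah_mul0l b : Ah_mul h 0 b = 0.
Proof. by rewrite Ah_mulE size_poly0 big_ord0. Qed.

Lemma Ah_mul0r a : Ah_mul h a 0 = 0.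
Proof. by rewrite Ah_mulE big1 // => i _; rewrite iter_ymul0 mulr0. Qed.

Lemma Ah_mul_suml I r (P : pred I) (E : I -> {poly {poly F}}) b :
  Ah_mul h (\sum_(i <- r | P i) E i) b = \sum_(i <- r | P i) Ah_mul h (E i) b.
Proof.
exact: (big_morph (Ah_mul h ^~ b) (fun x y => Ah_mulDl x y b) (Ah_mul0l b)).
Qed.

Lemma Ah_mul_sumr I r (P : pred I) (E : I -> {poly {poly F}}) a :
  Ah_mul h a (\sum_(i <- r | P i) E i) = \sum_(i <- r | P i) Ah_mul h a (E i).
Proof. exact: (big_morph (Ah_mul h a) (Ah_mulDr a) (Ah_mul0r a)). Qed.

Lemma Ah_mulCl c b : Ah_mul h c%:P b = c%:P * b.
Proof. by rewrite (@Ah_mul_wide 1) ?size_polyC_leq1 // big_ord1 coefC. Qed.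

Lemma Ah_mul1l b : Ah_mul h 1 b = b.
Proof. by rewrite -polyC1 Ah_mulCl mul1r. Qed.

Lemma Ah_mulXl b : Ah_mul h 'X b = ymul b.
Proof.
rewrite Ah_mulE size_polyX 2!big_ord_recl big_ord0 !coefX /=.
by rewrite mul0r add0r mul1r addr0.
Qed.

Lemma Ah_mulCMl c a b : Ah_mul h (c%:P * a) b = c%:P * Ah_mul h a b.
Proof.
pose n := maxn (size a) (size (c%:P * a)).
rewrite !(@Ah_mul_wide n) ?leq_maxl ?leq_maxr // mulr_sumr.
by apply: eq_bigr => i _; rewrite coefCM polyCM mulrA.
Qed.

(** Associativity when the leftmost factor is yhat; the two terms of the Leibniz rule [ymulCM] match
    the two terms of [ymul a]. The general case follows by iterating and using linearity in the left
    factor. *)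
Lemma Ah_mul_ymull a b : Ah_mul h (ymul a) b = ymul (Ah_mul h a b).
Proof.
have ymul_sum := big_morph _ ymulD ymul0.
rewrite [in RHS]Ah_mulE ymul_sum /ymul Ah_mulDl.
under [in RHS]eq_bigr do rewrite -/(ymul _) ymulCM.
rewrite big_split /=; congr (_ + _).
  rewrite (@Ah_mul_wide (size a).+1); last first.
    by rewrite (leq_trans (size_polyMleq _ _)) // size_polyX.
  rewrite big_ord_recl coefXM mul0r add0r; apply: eq_bigr => i _.
  by rewrite coefXM.
rewrite (@Ah_mul_wide (size a)); last first.
  by apply/leq_sizeP => j le_aj; rewrite coef_coef_der nth_default ?hder0.
by apply: eq_bigr => i _; rewrite coef_coef_der.
Qed.

Lemma Ah_mulA a b d : Ah_mul h a (Ah_mul h b d) = Ah_mul h (Ah_mul h a b) d.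
Proof.
rewrite (Ah_mulE a) [in RHS](Ah_mulE a) Ah_mul_suml; apply: eq_bigr => i _.
rewrite Ah_mulCMl; congr (_ * _).
by elim: (nat_of_ord i) => //= n ->; rewrite Ah_mul_ymull.
Qed.

Lemma ymulXn i : ymul 'X^i = 'X^(i.+1) :> {poly {poly F}}.
Proof.
rewrite /ymul exprS -[X in coef_der X]mulr1 coef_derXnM /coef_der.
by rewrite -polyC1 map_polyC /= -polyC1 derivC polyC0 !mulr0 addr0.
Qed.

Lemma Ah_mul1r a : Ah_mul h a 1 = a.
Proof.
rewrite Ah_mulE -[RHS]coefK poly_def; apply: eq_bigr => i _.
rewrite mul_polyC; congr (_ *: _).
by elim: (nat_of_ord i) => //= n ->; rewrite ymulXn.
Qed.


Lemma Ah_pow_mull a n b : Ah_mul h (Ah_pow h a n) b = iter n (Ah_mul h a) b.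
Proof.
by elim: n => [|n IHn] /=; rewrite ?Ah_mul1l // -IHn Ah_mulA.
Qed.

Lemma Ah_powC c n : Ah_pow h c%:P n = (c ^+ n)%:P.
Proof. by elim: n => //= n ->; rewrite Ah_mulCl exprS polyCM. Qed.

Lemma Ah_powX n : Ah_pow h 'X n = 'X^n.
Proof. by elim: n => //= n ->; rewrite Ah_mulXl ymulXn. Qed.

Lemma Ah_mul_affl g c b :
  Ah_mul h (g%:P * 'X + c%:P) b = g%:P * ymul b + c%:P * b.
Proof. by rewrite Ah_mulDl Ah_mulCMl Ah_mulXl Ah_mulCl. Qed.

Lemma ymulC c : ymul c%:P = c%:P * 'X + (hder h c)%:P.
Proof.
rewrite /ymul mulrC; congr (_ + _); apply/polyP => j.
by rewrite coef_coef_der !coefC; case: eqP => //; rewrite hder0.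
Qed.

End OreProduct.

Lemma coef_size_neq0 (R : nzRingType) (p : {poly R}) n :
  size p = n.+1 -> p`_n != 0.
Proof.
move=> sp; have -> : p`_n = lead_coef p by rewrite /lead_coef sp.
by rewrite lead_coef_eq0 -size_poly_eq0 sp.
Qed.

(** * Degree in yhat, reduction modulo h, and units *)

Section Degree.
Variables (F : fieldType) (h : {poly F}).
Implicit Types (a b : {poly {poly F}}) (c g u : {poly F}).

Lemma size_sum_dominant n (c : nat -> {poly F}) (B : nat -> {poly {poly F}}) :
    c n != 0 -> (0 < size (B n))%N ->
    (forall i, (i < n)%N -> (size (B i) < size (B n))%N) ->
  size (\sum_(i < n.+1) (c i)%:P * B i) = size (B n).
Proof.
move=> cn0 sB ltB; rewrite big_ord_recr /= addrC size_polyDl size_Cmul //.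
rewrite -(prednK sB) ltnS; apply: leq_trans (size_sum _ _ _) _.
apply/bigmax_leqP => i _; rewrite -ltnS prednK //.
have [-> | ci0] := eqVneq (c i) 0; first by rewrite mul0r size_poly0.
by rewrite size_Cmul // ltB.
Qed.

Lemma size_ymul b : b != 0 -> size (ymul h b) = (size b).+1.
Proof.
move=> b0; rewrite /ymul mulrC size_polyDl size_mulX // ltnS.
by apply/leq_sizeP => j le_bj; rewrite coef_coef_der nth_default ?hder0.
Qed.

Lemma iter_ymul_neq0 i b : b != 0 -> iter i (ymul h) b != 0.
Proof.
move=> b0; elim: i => //= i IHi.
by rewrite -size_poly_gt0 size_ymul.
Qed.

Lemma size_iter_ymul i b : b != 0 -> size (iter i (ymul h) b) = (i + size b)%N.
Proof.
move=> b0; elim: i => //= i IHi.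
by rewrite size_ymul ?iter_ymul_neq0 // IHi.
Qed.

Lemma size_Ah_mul a b : a != 0 -> b != 0 ->
  size (Ah_mul h a b) = (size a + size b).-1.
Proof.
move=> a0 b0; rewrite Ah_mulE.
have [n sa] : exists n, size a = n.+1.
  by exists (size a).-1; rewrite prednK ?size_poly_gt0.
rewrite sa (@size_sum_dominant n (fun i => a`_i)) ?size_iter_ymul //.
  exact: coef_size_neq0.
  by rewrite addn_gt0 size_poly_gt0 b0 orbT.
by move=> i lt_in; rewrite !size_iter_ymul // ltn_add2r.
Qed.

Lemma Ah_pow_neq0 a n : a != 0 -> Ah_pow h a n != 0.
Proof.
move=> a0; elim: n => [|n IHn] /=; first exact: oner_neq0.
rewrite -size_poly_gt0 size_Ah_mul //; move: a0 IHn; rewrite -!size_poly_gt0.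
by case: (size a) => // m _; case: (size (Ah_pow h a n)) => // k _; rewrite addnS.
Qed.

Lemma size_Ah_pow a n m : size a = m.+1 -> size (Ah_pow h a n) = (m * n).+1.
Proof.
move=> sa; have a0 : a != 0 by rewrite -size_poly_gt0 sa.
elim: n => [|n IHn]; first by rewrite muln0 size_poly1.
by rewrite /= size_Ah_mul ?Ah_pow_neq0 // -/(Ah_pow h a n) IHn sa addnS /= mulnS.
Qed.

(** Powers of an element of positive yhat-degree have strictly increasing degrees, so the top term
    cannot cancel and degrees multiply. Here [size a = m.+2] means degree m + 1. *)
Lemma size_Ah_eval n (c : nat -> {poly F}) a m : c n != 0 -> size a = m.+2 ->
  size (\sum_(i < n.+1) (c i)%:P * Ah_pow h a i) = (m.+1 * n).+1.
Proof.
move=> cn0 sa; rewrite (@size_sum_dominant n c) ?(size_Ah_pow _ sa) // => i lt_in.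
by rewrite !(size_Ah_pow _ sa) ltnS ltn_pmul2l.
Qed.

(** Modulo h the derivation [hder h] vanishes, so yhat acts as plain multiplication by ['X] and the
    product becomes that of the commutative ring [{poly {poly F}}]. *)
Lemma Ah_mul_modh a b : exists w, Ah_mul h a b = a * b + h%:P * w.
Proof.
have iterP i : exists w, iter i (ymul h) b = 'X^i * b + h%:P * w.
  elim: i => [|i [w Ew]]; first by exists 0; rewrite expr0 mul1r mulr0 addr0.
  exists ('X^i * map_poly (@deriv F) b + ymul h w + h^`()%:P * w).
  rewrite iterS Ew ymulD ymulCM /ymul coef_derXnM /hder polyCM exprS.
  by rewrite [in coef_der h b]/coef_der; ring.
rewrite Ah_mulE; suff [w ->] : exists w,
    \sum_(i < size a) (a`_i)%:P * iter i (ymul h) b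
    = (\sum_(i < size a) (a`_i)%:P * 'X^i) * b + h%:P * w.
  exists w; congr (_ * _ + _); rewrite -[RHS]coefK poly_def.
  by apply: eq_bigr => i _; rewrite mul_polyC.
elim: (size a) => [|n [w IHn]].
  by exists 0; rewrite !big_ord0 mul0r mulr0 addr0.
have [v Ev] := iterP n; exists (w + (a`_n)%:P * v).
by rewrite !big_ord_recr /= IHn Ev; ring.
Qed.

(** Additivity of the yhat-degree puts both factors in F[x], whose units are the nonzero scalars. *)
Lemma Ah_mul_eq1 a b : Ah_mul h a b = 1 -> exists2 c, c != 0 & a = c%:P%:P.
Proof.
move=> ab1.
have a0 : a != 0.
  by apply: contra_eq_neq ab1 => ->; rewrite Ah_mul0l eq_sym oner_neq0.
have b0 : b != 0.
  by apply: contra_eq_neq ab1 => ->; rewrite Ah_mul0r eq_sym oner_neq0.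
have := size_Ah_mul a0 b0; rewrite ab1 size_poly1.
have: (0 < size a)%N by rewrite size_poly_gt0.
have: (0 < size b)%N by rewrite size_poly_gt0.
case Ea: (size a) => [//|m]; case Eb: (size b) => [//|n] _ _.
rewrite addnS /= => /esym/eqP; rewrite addSn eqSS addn_eq0 => /andP[/eqP m0 /eqP n0].
have {m0}/size1_polyC Ea' : (size a <= 1)%N by rewrite Ea m0.
have {n0}/size1_polyC Eb' : (size b <= 1)%N by rewrite Eb n0.
move: ab1; rewrite Ea' Eb' Ah_mulCl -polyCM -polyC1 => /polyC_inj ab1.
have : a`_0 \is a GRing.unit by apply/unitrPr; exists b`_0.
rewrite poly_unitE => /andP[/eqP sa ua].
exists (a`_0)`_0; first by rewrite -unitfE.
by congr (_%:P); apply: size1_polyC; rewrite sa.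
Qed.

End Degree.

(** * Algebra endomorphisms and their determination by the generators x and yhat *)

Section Endomorphisms.
Variables (F : fieldType) (h : {poly F}).
Implicit Types (a b : {poly {poly F}}) (c f g u : {poly F}).
Implicit Types s t : {poly {poly F}} -> {poly {poly F}}.

(** Bijectivity is left out so that maps given on the generators can be compared and composed before
    their inverses are known. *)
Definition is_end s : Prop :=
  [/\ forall a b, s (a + b) = s a + s b,
      forall (c : F) a, s (c%:P%:P * a) = c%:P%:P * s a,
      s 1 = 1
    & forall a b, s (Ah_mul h a b) = Ah_mul h (s a) (s b)].

Lemma is_aut_end s : is_aut h s -> is_end s.
Proof. by case. Qed.

Lemma is_end_id : is_end id.
Proof. by []. Qed.

Lemma is_end_comp s t : is_end s -> is_end t -> is_end (s \o t).
Proof.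
case=> sD sZ s1 sM [tD tZ t1 tM]; split=> [a b|c a||a b] /=.
- by rewrite tD sD.
- by rewrite tZ sZ.
- by rewrite t1.
by rewrite tM sM.
Qed.

Lemma is_end0 s : is_end s -> s 0 = 0.
Proof. by case=> sD _ _ _; apply: (addrI (s 0)); rewrite -sD !addr0. Qed.

Lemma is_end_pow s a n : is_end s -> s (Ah_pow h a n) = Ah_pow h (s a) n.
Proof. by case=> _ _ s1 sM; elim: n => //= n <-; rewrite sM. Qed.

Lemma is_endC s g : is_end s ->
  s g%:P = \sum_(i < size g) (g`_i)%:P%:P * Ah_pow h (s 'X%:P) i.
Proof.
move=> sE; have [sD sZ _ _] := sE.
rewrite -[in LHS](coefK g) poly_def rmorph_sum /= (big_morph _ sD (is_end0 sE)).
apply: eq_bigr => i _; rewrite -mul_polyC polyCM sZ -is_end_pow //.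
by rewrite Ah_powC.
Qed.

Lemma is_endE s a : is_end s ->
  s a = \sum_(j < size a) Ah_mul h (s (a`_j)%:P) (Ah_pow h (s 'X) j).
Proof.
move=> sE; have [sD _ _ sM] := sE.
rewrite -[in LHS](coefK a) poly_def (big_morph _ sD (is_end0 sE)).
apply: eq_bigr => j _.
by rewrite -is_end_pow // -sM Ah_powX Ah_mulCl mul_polyC.
Qed.

Lemma eq_is_end s t : is_end s -> is_end t ->
  s 'X%:P = t 'X%:P -> s 'X = t 'X -> s =1 t.
Proof.
move=> sE tE eqx eqy a; rewrite (is_endE a sE) (is_endE a tE) eqy.
by apply: eq_bigr => j _; rewrite (is_endC _ sE) (is_endC _ tE) eqx.
Qed.

Lemma is_endC_comp s u g : is_end s -> s 'X%:P = u%:P ->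
  s g%:P = (g \Po u)%:P.
Proof.
move=> sE sx; rewrite is_endC // sx comp_polyE rmorph_sum /=.
by apply: eq_bigr => i _; rewrite Ah_powC -polyCM mul_polyC.
Qed.

(* The map x |-> u, yhat |-> V; it is multiplicative only when V and u satisfy
   the defining relation of A_h. *)
Definition Ah_subst u V a : {poly {poly F}} :=
  \sum_(j < size a) (a`_j \Po u)%:P * Ah_pow h V j.

Lemma is_endE_subst s u a : is_end s -> s 'X%:P = u%:P ->
  s a = Ah_subst u (s 'X) a.
Proof.
move=> sE sx; rewrite is_endE //; apply: eq_bigr => j _.
by rewrite (is_endC_comp _ sE sx) Ah_mulCl.
Qed.

Lemma Ah_subst_wide n u V a : (size a <= n)%N ->
  Ah_subst u V a = \sum_(j < n) (a`_j \Po u)%:P * Ah_pow h V j.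
Proof.
move=> le_an; rewrite /Ah_subst.
rewrite (big_ord_widen _ (fun j => (a`_j \Po u)%:P * Ah_pow h V j) le_an).
rewrite big_mkcond; apply: eq_bigr => i _; case: ltnP => // le_ai.
by rewrite nth_default // comp_poly0 polyC0 mul0r.
Qed.

Lemma Ah_substD u V a b : Ah_subst u V (a + b) = Ah_subst u V a + Ah_subst u V b.
Proof.
pose n := maxn (size a) (size b).
rewrite !(@Ah_subst_wide n) ?leq_maxl ?leq_maxr //; last exact: size_polyD.
rewrite -big_split /=; apply: eq_bigr => i _.
by rewrite coefD comp_polyD polyCD mulrDl.
Qed.

Lemma Ah_substC u V c : Ah_subst u V c%:P = (c \Po u)%:P.
Proof.
by rewrite (@Ah_subst_wide 1) ?size_polyC_leq1 // big_ord1 coefC /= mulr1.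
Qed.

Lemma Ah_substX u V : Ah_subst u V 'X = V.
Proof.
rewrite /Ah_subst size_polyX 2!big_ord_recl big_ord0 !coefX /=.
by rewrite comp_poly0 mul0r add0r -polyC1 comp_polyC mul1r addr0 Ah_mul1r.
Qed.

Lemma Ah_substCM u V c a : Ah_subst u V (c%:P * a) = (c \Po u)%:P * Ah_subst u V a.
Proof.
pose n := maxn (size a) (size (c%:P * a)).
rewrite !(@Ah_subst_wide n) ?leq_maxl ?leq_maxr // mulr_sumr.
by apply: eq_bigr => i _; rewrite coefCM comp_polyM polyCM mulrA.
Qed.

Section Relation.
Variables (u : {poly F}) (V : {poly {poly F}}).
(** The relation yhat g - g yhat = h g' transported by the substitution, required for every g so
    that it can be applied to each coefficient. *)
Hypothesis relV : forall g,
  Ah_mul h V (g \Po u)%:P = (g \Po u)%:P * V + (hder h g \Po u)%:P.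

Lemma Ah_subst_ymul a : Ah_subst u V (ymul h a) = Ah_mul h V (Ah_subst u V a).
Proof.
rewrite [in RHS]/Ah_subst Ah_mul_sumr.
under [in RHS]eq_bigr do
  rewrite -(Ah_mulCl h) Ah_mulA relV Ah_mulDl Ah_mulCMl Ah_mulCl.
rewrite big_split /= /ymul Ah_substD; congr (_ + _).
  rewrite (@Ah_subst_wide (size a).+1); last first.
    by rewrite (leq_trans (size_polyMleq _ _)) // size_polyX.
  rewrite big_ord_recl coefXM comp_poly0 mul0r add0r; apply: eq_bigr => i _.
  by rewrite coefXM.
rewrite (@Ah_subst_wide (size a)); last first.
  by apply/leq_sizeP => j le_aj; rewrite coef_coef_der nth_default ?hder0.
by apply: eq_bigr => i _; rewrite coef_coef_der.
Qed.

(** Multiplicativity in the left factor reduces to left multiplication by yhat, which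
    [Ah_subst_ymul] turns into left multiplication by V. *)
Lemma is_end_subst : is_end (Ah_subst u V).
Proof.
split=> [a b|c a||a b]; first exact: Ah_substD.
- by rewrite Ah_substCM comp_polyC.
- by rewrite -polyC1 Ah_substC -polyC1 comp_polyC.
have Ah_subst0 : Ah_subst u V 0 = 0 by rewrite /Ah_subst size_poly0 big_ord0.
rewrite Ah_mulE (big_morph _ (Ah_substD u V) Ah_subst0).
rewrite {2}/Ah_subst Ah_mul_suml; apply: eq_bigr => i _.
rewrite Ah_substCM Ah_mulCMl Ah_pow_mull; congr (_ * _).
by elim: (nat_of_ord i) => //= n <-; rewrite Ah_subst_ymul.
Qed.

End Relation.

End Endomorphisms.

(** * The affine group attached to h and the automorphisms built from it *)

Section Group.
Variables (F : fieldType) (h : {poly F}).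
Hypothesis hdeg : (1 < size h)%N.
Implicit Types (a b : {poly {poly F}}) (c f g u : {poly F}).
Implicit Types s t : {poly {poly F}} -> {poly {poly F}}.

Lemma comp_aff (a b a' b' : F) :
  aff a b \Po aff a' b' = aff (a * a') (a * b' + b).
Proof.
rewrite comp_polyD comp_polyZ comp_polyX comp_polyC scalerDr scalerA polyCD polyCM.
by rewrite mul_polyC addrA.
Qed.

Lemma inP_comp (a b a' b' : F) :
  inP h a b -> inP h a' b' -> inP h (a * a') (a * b' + b).
Proof.
move=> [a0 ha] [a'0 ha']; split; first exact: mulf_neq0.
by rewrite -comp_aff comp_polyA ha comp_polyZ ha' scalerA exprMn.
Qed.

Lemma aff10 : aff (1 : F) 0 = 'X.
Proof. by rewrite scale1r addr0. Qed.

Lemma inP10 : inP h 1 0.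
Proof. by split; rewrite ?oner_neq0 // aff10 comp_polyXr expr1n scale1r. Qed.

Lemma aff_invl (a b : F) : a != 0 -> aff a^-1 (- (a^-1 * b)) \Po aff a b = 'X.
Proof. by move=> a0; rewrite comp_aff mulVf // subrr aff10. Qed.

Lemma aff_invr (a b : F) : a != 0 -> aff a b \Po aff a^-1 (- (a^-1 * b)) = 'X.
Proof.
by move=> a0; rewrite comp_aff mulfV // mulrN mulrA mulfV // mul1r addNr aff10.
Qed.

Lemma inP_inv (a b : F) : inP h a b -> inP h a^-1 (- (a^-1 * b)).
Proof.
move=> [a0 ha]; split; first by rewrite invr_eq0.
have := congr1 (comp_poly (aff a^-1 (- (a^-1 * b)))) ha.
rewrite -comp_polyA aff_invr // comp_polyXr comp_polyZ exprVn => hE.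
by rewrite [X in _ = _ *: X]hE scalerA mulVf ?scale1r // expf_neq0.
Qed.

(** The general element of the semidirect product of the phi_f with tau_P; [(size h).-2] is deg h -
    1. *)
Definition Ah_aut (al be : F) f : {poly {poly F}} -> {poly {poly F}} :=
  Ah_subst h (aff al be) ((al ^+ (size h).-2)%:P%:P * 'X + f%:P).

Lemma Ah_autC al be f c : Ah_aut al be f c%:P = (c \Po aff al be)%:P.
Proof. exact: Ah_substC. Qed.

Lemma Ah_autX al be f :
  Ah_aut al be f 'X = (al ^+ (size h).-2)%:P%:P * 'X + f%:P.
Proof. exact: Ah_substX. Qed.

(** By the chain rule g(al x + be) has a derivative carrying a factor al, while h(al x + be) =
    al^(deg h) h; the scalar al^(deg h - 1) on yhat balances the two. *)
Lemma is_end_Ah_aut al be f : inP h al be -> is_end h (Ah_aut al be f).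
Proof.
move=> [al0 hal]; apply: is_end_subst => g.
rewrite Ah_mul_affl ymulC /hder deriv_comp comp_polyM hal.
rewrite derivD derivZ derivX derivC addr0.
have -> : (size h).-1 = (size h).-2.+1 by case: (size h) hdeg => [|[]].
by rewrite exprS -!mul_polyC !polyCM mulr1; ring.
Qed.

Lemma Ah_aut_comp al be f al' be' f' : inP h al be -> inP h al' be' ->
  Ah_aut al be f \o Ah_aut al' be' f'
    =1 Ah_aut (al' * al) (al' * be + be')
         (al' ^+ (size h).-2 *: f + (f' \Po aff al be)).
Proof.
move=> P1 P2; have E1 := is_end_Ah_aut f P1; have E2 := is_end_Ah_aut f' P2.
apply: (eq_is_end (is_end_comp E1 E2) (is_end_Ah_aut _ (inP_comp P2 P1))).
  by rewrite /= !Ah_autC !comp_polyX comp_aff.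
have [sD sZ _ _] := E1.
rewrite /= !Ah_autX sD sZ Ah_autX Ah_autC exprMn.
by rewrite -[_ *: f]mul_polyC !(polyCM, polyCD); ring.
Qed.

Lemma Ah_aut1 : Ah_aut 1 0 0 =1 id.
Proof.
apply: (eq_is_end (is_end_Ah_aut _ inP10) (is_end_id h)).
  by rewrite Ah_autC aff10 comp_polyXr.
by rewrite Ah_autX expr1n mul1r addr0.
Qed.

Lemma is_aut_Ah_aut al be f : inP h al be -> is_aut h (Ah_aut al be f).
Proof.
move=> Pab; have [sD sZ s1 sM] := is_end_Ah_aut f Pab.
split=> //; have Pinv := inP_inv Pab; have [al0 _] := Pab.
set al' := al^-1 in Pinv; set be' := - _ in Pinv.
(* Chosen so that the polynomial part in [Ah_aut_comp] vanishes for both composites. *)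
pose f' := - (al' ^+ (size h).-2 *: (f \Po aff al' be')).
exists (Ah_aut al' be' f') => a.
  rewrite -[LHS]/((Ah_aut al' be' f' \o Ah_aut al be f) a) Ah_aut_comp //.
  rewrite -[RHS]Ah_aut1 /al' mulfV // /be' mulrN mulrA mulfV // mul1r addNr.
  by rewrite scalerN scalerA -exprMn mulfV // expr1n scale1r addNr.
rewrite -[LHS]/((Ah_aut al be f \o Ah_aut al' be' f') a) Ah_aut_comp //.
rewrite -[RHS]Ah_aut1 /al' mulVf // /be' subrr.
rewrite linearN linearZ /= -comp_polyA aff_invl // comp_polyXr.
by rewrite subrr.
Qed.

Lemma phiE f : phi h f =1 Ah_aut 1 0 f.
Proof.
move=> a; apply: eq_bigr => j _.
by rewrite Ah_mulCl aff10 comp_polyXr expr1n mul1r.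
Qed.

End Group.

(** * Classification of the automorphisms and of the central ones *)

Section Classification.
Variables (F : fieldType) (h : {poly F}).
Hypothesis hdeg : (1 < size h)%N.
Implicit Types (a b : {poly {poly F}}) (c f g u : {poly F}).
Implicit Types s t : {poly {poly F}} -> {poly {poly F}}.

Lemma is_aut_inv s : is_aut h s ->
  exists t, [/\ is_aut h t, cancel s t & cancel t s].
Proof.
case=> -[t sK tK] sD sZ s1 sM; exists t; split=> //; split.
- by exists s.
- by move=> a b; rewrite -{1}[a]tK -{1}[b]tK -sD sK.
- by move=> c a; rewrite -{1}[a]tK -sZ sK.
- by rewrite -s1 sK.
by move=> a b; rewrite -{1}[a]tK -{1}[b]tK -sM sK.
Qed.

Lemma Ah_mul_yx : Ah_mul h 'X 'X%:P = Ah_mul h 'X%:P 'X + h%:P.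
Proof. by rewrite Ah_mulXl ymulC Ah_mulCl /hder derivX mulr1. Qed.

(** The image of h = [yhat, x] is again a commutator, hence zero modulo h. *)
Lemma is_end_h_dvd s : is_end h s -> exists w, s h%:P = h%:P * w.
Proof.
case=> sD _ _ sM; have := congr1 s Ah_mul_yx; rewrite sD !sM.
have [w ->] := Ah_mul_modh h (s 'X) (s 'X%:P).
have [v ->] := Ah_mul_modh h (s 'X%:P) (s 'X) => E; exists (w - v).
apply: (addrI (s 'X%:P * s 'X + h%:P * v)); rewrite -E; ring.
Qed.

Lemma is_aut_h s : is_aut h s -> exists2 c : F, c != 0 & s h%:P = c%:P%:P * h%:P.
Proof.
move=> sA; have [t [tA sK tK]] := is_aut_inv sA.
have [w sh] := is_end_h_dvd (is_aut_end sA).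
have [v th] := is_end_h_dvd (is_aut_end tA).
have [_ _ _ _ sM] := sA.
have h0 : h%:P != 0 :> {poly {poly F}}.
  by rewrite polyC_eq0 -size_poly_gt0 ltnW.
(* From s h = h w and t h = h v one gets h = s (t h) = h w (s v), so w is a unit and therefore a
   scalar. *)
have [|c c0 Ew] := @Ah_mul_eq1 _ h w (s v).
  apply: (mulfI h0); rewrite mulr1 -Ah_mulCMl -sh -sM Ah_mulCl -th.
  exact: tK.
by exists c => //; rewrite sh Ew mulrC.
Qed.

(** If s x had yhat-degree m + 1, then s h = h(s x) would have degree (m + 1) deg h > 0, but s h = c
    h has degree 0. *)
Lemma is_aut_x_poly s : is_aut h s -> exists u, s 'X%:P = u%:P.
Proof.
move=> sA; suff : (size (s 'X%:P) <= 1)%N.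
  by move/size1_polyC=> ->; exists (s 'X%:P)`_0.
have [c c0 sh] := is_aut_h sA.
rewrite leqNgt; apply/negP => sx_gt1.
have [m Em] : exists m, size (s 'X%:P) = m.+2.
  by exists (size (s 'X%:P)).-2; case: (size _) sx_gt1 => [|[]].
have [n En] : exists n, size h = n.+2.
  by exists (size h).-2; case: (size _) hdeg => [|[]].
have := is_endC h (is_aut_end sA); rewrite sh En.
move/(congr1 (fun p => size (polyseq p))).
rewrite (@size_Ah_eval _ _ n.+1 (fun i => (h`_i)%:P) _ _ _ Em).
  by rewrite -polyCM; have /[swap] -> := size_polyC_leq1 (c%:P * h).
by rewrite polyC_eq0 coef_size_neq0.
Qed.

Lemma is_aut_x s : is_aut h s ->
  exists al be, inP h al be /\ s 'X%:P = (aff al be)%:P.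
Proof.
move=> sA; have [t [tA sK tK]] := is_aut_inv sA.
have [u sx] := is_aut_x_poly sA; have [v tx] := is_aut_x_poly tA.
have := sK 'X%:P; rewrite sx (is_endC_comp _ (is_aut_end tA) tx) => /polyC_inj uv.
(* The composite of u with v is x, so degrees multiply to 1 and u is affine. *)
have := size_comp_poly u v; rewrite uv size_polyX /= => /esym/eqP.
rewrite muln_eq1 => /andP[/eqP su1 _].
have su : size u = 2 by case: (size u) su1 => [|[|[]]].
have u1 := coef_size_neq0 su.
have Eu : u = aff u`_1 u`_0.
  rewrite -[LHS]coefK su poly_def 2!big_ord_recl big_ord0 /= addr0 expr0 expr1.
  by rewrite addrC alg_polyC.
exists u`_1, u`_0; split; last by rewrite -Eu.
split=> //; rewrite -Eu.
have [c c0 sh] := is_aut_h sA.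
move: sh; rewrite (is_endC_comp _ (is_aut_end sA) sx) -polyCM => /polyC_inj sh.
(* Comparing leading coefficients in h(u) = c h identifies c with al^(deg h), which is the condition
   for P. *)
have := congr1 lead_coef sh; rewrite lead_coef_comp ?su // lead_coefM lead_coefC.
rewrite sh mul_polyC mulrC {1 2}/lead_coef su => /mulIf ->//.
by rewrite lead_coef_eq0 -size_poly_gt0 ltnW.
Qed.

(** Since yhat = s (t yhat) is a polynomial expression in s yhat with coefficients in F[x], the
    yhat-degree of s yhat divides 1; degree 0 would put yhat in F[x]. *)
Lemma is_aut_y s : is_aut h s -> exists g f, s 'X = g%:P * 'X + f%:P.
Proof.
move=> sA; have [t [tA sK tK]] := is_aut_inv sA.
have [al [be [[al0 _] sx]]] := is_aut_x sA.
suff : size (s 'X) = 2%N.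
  move=> sy; exists (s 'X)`_1, (s 'X)`_0.
  rewrite -[LHS]coefK sy poly_def 2!big_ord_recl big_ord0 /= addr0 expr0 expr1.
  by rewrite addrC alg_polyC mul_polyC.
have := congr1 (fun p => size (polyseq p)) (tK 'X).
rewrite (is_endE_subst _ (is_aut_end sA) sx) size_polyX /Ah_subst.
have Ea : size (t 'X) = (size (t 'X)).-1.+1.
  rewrite prednK // size_poly_gt0; apply: contra_eq_neq (tK 'X) => ->.
  by rewrite (is_end0 (is_aut_end sA)) eq_sym polyX_eq0.
set n := (size (t 'X)).-1 in Ea; rewrite Ea.
have [sy_le1|] := leqP (size (s 'X)) 1.
  rewrite (size1_polyC sy_le1) => E; suff: (2 <= 1)%N by [].
  rewrite -[X in (X <= _)%N]E.
  under eq_bigr do rewrite Ah_powC -polyCM.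
  by rewrite -rmorph_sum size_polyC_leq1.
case Em: (size (s 'X)) => [|[|m]] // _.
rewrite (size_Ah_eval h (c := fun i => (t 'X)`_i \Po aff al be) _ Em).
  by case=> /eqP; rewrite muln_eq1 => /andP[/eqP -> _].
rewrite comp_poly_eq0 ?coef_size_neq0 //.
by rewrite size_polyDl size_scale // size_polyX // ltnS size_polyC_leq1.
Qed.

Lemma is_autE s : is_aut h s ->
  exists al be f, inP h al be /\ s =1 Ah_aut h al be f.
Proof.
move=> sA; have [al [be [Pab sx]]] := is_aut_x sA.
have [g [f sy]] := is_aut_y sA; exists al, be, f; split=> // a.
have sE := is_aut_end sA; have [sD _ _ sM] := sE; have [al0 hal] := Pab.
rewrite (is_endE_subst _ sE sx) sy.
suff -> : g = (al ^+ (size h).-2)%:P by [].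
(* The part of yhat-degree 0 in the image of yhat x = x yhat + h reads g al h = al^(deg h) h, which
   determines g. *)
have := congr1 s Ah_mul_yx.
rewrite sD !sM (is_endC_comp h sE sx) sx sy Ah_mul_affl Ah_mulCl ymulC hal.
rewrite /hder derivD derivZ derivX derivC addr0 => /polyP/(_ 0%N).
rewrite !(coefD, coefCM, coefC, coefX) /= !(mulr0, add0r) addrC [f * _]mulrC.
have h0 : h != 0 by rewrite -size_poly_gt0 ltnW.
move/addrI; have -> : (size h).-1 = (size h).-2.+1 by case: (size h) hdeg => [|[]].
rewrite alg_polyC exprSr -mul_polyC polyCM /= => E.
have al0' : al%:P != 0 :> {poly F} by rewrite polyC_eq0.
by apply/(mulIf al0')/(mulIf h0); rewrite -E mulrAC mulrA.
Qed.

Lemma comp_poly_aff10 (r : {poly F}) : r \Po aff 1 0 = r.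
Proof. by rewrite aff10 comp_polyXr. Qed.

Lemma is_central_autP s :
  is_central_aut h s <-> exists r, inDZ h r /\ s =1 phi h r.
Proof.
split=> [[sA sC] | [r [rD sE]]].
  have [al [be [f [Pab sE]]]] := is_autE sA.
  (* Commutation with [Ah_aut h z e g], evaluated at yhat and read in yhat-degree 0. *)
  have fC z e g : inP h z e ->
      al ^+ (size h).-2 *: g + (f \Po aff z e)
      = z ^+ (size h).-2 *: f + (g \Po aff al be).
    move=> Pze; have := sC _ (is_aut_Ah_aut hdeg g Pze) 'X.
    rewrite /= !sE.
    rewrite -[Ah_aut _ al be f _]/((Ah_aut h al be f \o Ah_aut h z e g) 'X).
    rewrite -[Ah_aut _ z e g _]/((Ah_aut h z e g \o Ah_aut h al be f) 'X).
    rewrite !Ah_aut_comp // !Ah_autX mulrC => /polyP/(_ 0%N).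
    by rewrite !(coefD, coefMX, coefXM, coefC) /= !add0r.
  (* Commutation with every phi_g; taking g = 1 and then g = x forces al = 1 and be = 0. *)
  have gC g : al ^+ (size h).-2 *: g = g \Po aff al be.
    have := fC _ _ g (inP10 h).
    by rewrite comp_poly_aff10 expr1n scale1r addrC => /addrI.
  have := gC 1; rewrite -polyC1 comp_polyC polyC1 => al1.
  have {al1}al1 : al ^+ (size h).-2 = 1.
    by apply: (@polyC_inj F); rewrite -alg_polyC al1.
  have := gC 'X; rewrite al1 scale1r comp_polyX => E.
  have := congr1 (coefp 0) E; have := congr1 (coefp 1) E => /=.
  rewrite !(coefD, coefZ, coefX, coefC) /= mulr1 mulr0 addr0 add0r => a1 b0.
  subst al be; exists f; split; last by move=> a; rewrite sE phiE.
  (* Commutation with tau_{z,e} alone, the case g = 0, is the defining condition of D_Z. *)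
  move=> z e Pze; have := fC _ _ 0 Pze.
  by rewrite scaler0 add0r comp_poly0 addr0.
have aE a : s a = Ah_aut h 1 0 r a by rewrite sE phiE.
have rA := is_aut_Ah_aut hdeg r (inP10 h).
have sA : is_aut h s.
  have [bij rAD rAZ rA1 rAM] := rA; split=> [|a b|c a||a b]; rewrite ?aE //.
  exact: eq_bij bij _ (fsym aE).
split=> // t tA a; have [al [be [f [Pab tE]]]] := is_autE tA.
rewrite /= aE tE tE aE.
rewrite -[LHS]/((Ah_aut h 1 0 r \o Ah_aut h al be f) a).
rewrite -[RHS]/((Ah_aut h al be f \o Ah_aut h 1 0 r) a).
rewrite !Ah_aut_comp //; try exact: inP10.
rewrite comp_poly_aff10 mulr1 mulr0 !mul1r add0r addr0 expr1n scale1r.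
by rewrite rD // addrC.
Qed.

(** Differentiate h(z x + e) = z^(deg h) h and cancel one factor z. *)
Lemma inDZ_deriv (c : F) : inDZ h (c *: h^`()).
Proof.
move=> z e [z0 hz]; rewrite comp_polyZ scalerA mulrC -scalerA; congr (_ *: _).
have := congr1 (@deriv F) hz.
rewrite deriv_comp derivD !derivZ derivX derivC addr0 mulrC -mul_polyC mulr1.
have -> : (size h).-1 = (size h).-2.+1 by case: (size h) hdeg => [|[]].
by rewrite mul_polyC exprS -scalerA => /(scalerI z0).
Qed.

End Classification.

(** * Polynomials invariant under finite translation groups and eigenvectors of scalings *)

Section Invariants.
Variable F : fieldType.
Implicit Types (r s p q : {poly F}) (G : seq F) (la nu z : F).

Lemma perm_map_stable (T : eqType) (f : T -> T) (s : seq T) :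
  injective f -> uniq s -> {in s, forall x, f x \in s} -> perm_eq (map f s) s.
Proof.
move=> f_inj Us fs; have Ufs : uniq (map f s) by rewrite map_inj_uniq.
apply: uniq_perm => //; apply: (uniq_min_size Ufs _ _).2; last by rewrite size_map.
by move=> _ /mapP[x xs ->]; apply: fs.
Qed.

Lemma coef_comp_scaleX (a : F) p i : (p \Po (a *: 'X))`_i = p`_i * a ^+ i.
Proof.
rewrite comp_polyE.
under eq_bigr do rewrite exprZn scalerA.
rewrite -(poly_def _ (fun i => p`_i * a ^+ i)) coef_poly.
by case: ltnP => // le_pi; rewrite nth_default ?mul0r.
Qed.

Lemma comp_poly_inj q : (1 < size q)%N -> injective (comp_poly q).
Proof.
move=> sq p r E; apply/eqP; rewrite -subr_eq0 -(comp_poly_eq0 _ sq).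
by rewrite comp_polyB E subrr.
Qed.

Lemma infinite_nonroot p : (forall e : seq F, exists y, y \notin e) ->
  p != 0 -> exists x, p.[x] != 0.
Proof.
move=> Finf p0.
(* As many distinct points as [size p], one more than the degree, so they cannot all be roots. *)
have [e /andP[Ue /eqP se]] : exists e : seq F, uniq e && (size e == size p).
  elim: (size p) => [|n [e /andP[Ue /eqP <-]]]; first by exists [::].
  by have [y ye] := Finf e; exists (y :: e); rewrite /= ye Ue eqxx.
have /allPn[x _ px] : ~~ all (root p) e.
  by apply/negP => /(max_poly_roots p0)/(_ Ue); rewrite se ltnn.
by exists x.
Qed.

(** Its roots are the -(la + nu). With la = 0 it is t of case (2); with la = be / (al - 1), its
    powers n and l are q and t of case (4). *)
Definition orbit_poly G la : {poly F} := \prod_(nu <- G) ('X + (la + nu)%:P).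

Lemma orbit_polyE G la :
  orbit_poly G la = \prod_(nu <- G) ('X - (- (la + nu))%:P).
Proof. by apply: eq_bigr => nu _; rewrite polyCN opprK. Qed.

Lemma size_orbit_poly G la : size (orbit_poly G la) = (size G).+1.
Proof. by rewrite orbit_polyE size_prod_XsubC. Qed.

Lemma orbit_poly_monic G la : orbit_poly G la \is monic.
Proof. by rewrite orbit_polyE monic_prod_XsubC. Qed.

Lemma orbit_poly0 G : orbit_poly G 0 = \prod_(nu <- G) ('X + nu%:P).
Proof. by apply: eq_bigr => nu _; rewrite add0r. Qed.

(** Each factor satisfies z x + e + la + nu = z (x + la + nu') with nu' = z^-1 (nu + e + la - z la),
    so the substitution permutes the factors up to the scalar z. *)
Lemma orbit_poly_aff G la z e : z != 0 ->
    perm_eq [seq z^-1 * (nu + (e + la - z * la)) | nu <- G] G ->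
  orbit_poly G la \Po aff z e = z ^+ size G *: orbit_poly G la.
Proof.
move=> z0 permG; rewrite [in RHS]/orbit_poly -(perm_big _ permG) big_map /=.
rewrite /orbit_poly (rmorph_prod (comp_poly (aff z e))) /=.
have -> : z ^+ size G = \prod_(nu <- G) z.
  by rewrite big_const_seq count_predT iter_mulr mulr1.
rewrite -scaler_prod; apply: eq_bigr => nu _.
rewrite comp_polyD comp_polyX comp_polyC -addrA -polyCD scalerDr -mul_polyC.
rewrite -[z *: _%:P]mul_polyC -polyCM mulrDr mulrA mulfV //.
by congr (_ + _%:P); ring.
Qed.

Section Group.
Variable G : seq F.
Hypotheses (Guniq : uniq G) (G0 : 0 \in G).
Hypothesis GD : forall mu nu, mu \in G -> nu \in G -> mu + nu \in G.

Lemma size_G_gt0 : (0 < size G)%N.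
Proof. by case: G G0. Qed.

Lemma orbit_poly_shift nu la : nu \in G ->
  orbit_poly G la \Po aff 1 nu = orbit_poly G la.
Proof.
move=> Gnu; rewrite orbit_poly_aff ?oner_neq0 ?expr1n ?scale1r //.
apply: perm_map_stable => //.
  by move=> x y /(mulfI _)/addIr; apply; rewrite invr1 oner_neq0.
by move=> mu Gmu; rewrite invr1 !mul1r addrK GD.
Qed.

Lemma invariant_polyP r :
  (forall nu, nu \in G -> r \Po aff 1 nu = r)
    <-> exists s, r = s \Po orbit_poly G 0.
Proof.
split=> [|[s ->] nu Gnu]; last by rewrite -comp_polyA orbit_poly_shift.
have [n] := ubnP (size r); elim: n r => // n IHn r le_rn rG.
have [E | r0] := eqVneq (r - r.[0]%:P) 0.
  by exists r.[0]%:P; rewrite comp_polyC; apply/eqP; rewrite -subr_eq0 E.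
have rootG : all (root (r - r.[0]%:P)) [seq - nu | nu <- G].
  apply/allP => _ /mapP[nu Gnu ->]; rewrite /root !hornerE subr_eq0.
  by rewrite -{1}(rG _ Gnu) horner_comp hornerD hornerZ hornerX hornerC mul1r addNr.
have Uopp : uniq [seq - nu | nu <- G] by rewrite map_inj_uniq //; apply: oppr_inj.
have [|q] := uniq_roots_prod_XsubC rootG; first by rewrite uniq_rootsE.
rewrite big_map; under eq_bigr do rewrite polyCN opprK.
rewrite -orbit_poly0 => rE.
have T0 := monic_neq0 (orbit_poly_monic G 0).
have [||s qE] := IHn q.
- have q0 : q != 0 by apply: contraNneq r0 => q0; rewrite rE q0 mul0r.
  have sr : (size (r - r.[0]%:P)%R <= size r)%N.
    have [E0 | rn0] := eqVneq r 0.
      by case/eqP: r0; rewrite E0 horner0 polyC0 subrr.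
    rewrite (leq_trans (size_polyD _ _)) // geq_max leqnn size_polyN.
    by rewrite (leq_trans (size_polyC_leq1 _)) ?size_poly_gt0.
  apply: (leq_trans _ (leq_trans sr le_rn)); rewrite rE.
  rewrite size_Mmonic ?orbit_poly_monic // size_orbit_poly addnS /=.
  by rewrite -addn1 leq_add2l size_G_gt0.
(* The quotient q is invariant because both r - r(0) and the orbit polynomial are, and the latter
   can be cancelled. *)
- move=> nu Gnu; apply: (mulIf T0); rewrite -{1}(orbit_poly_shift 0 Gnu).
  by rewrite -comp_polyM -rE comp_polyB comp_polyC rG.
exists (s * 'X + r.[0]%:P).
rewrite comp_polyD comp_polyM comp_polyX comp_polyC -qE -rE.
by rewrite subrK.
Qed.

(** Translation by la commutes with the translations in G and carries the case of base point 0 to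
    the general one. *)
Lemma invariant_poly_shiftP la r :
  (forall nu, nu \in G -> r \Po aff 1 nu = r)
    <-> exists s, r = s \Po orbit_poly G la.
Proof.
split=> [rG|[s ->] nu Gnu]; last by rewrite -comp_polyA orbit_poly_shift.
have [|s sE] := (invariant_polyP (r \Po aff 1 (- la))).1.
  move=> nu Gnu; rewrite -{2}(rG _ Gnu) -!comp_polyA !comp_aff.
  by congr (_ \Po (_ *: _ + _%:P)); ring.
exists s; have -> : orbit_poly G la = orbit_poly G 0 \Po aff 1 la.
  rewrite /orbit_poly (rmorph_prod (comp_poly (aff 1 la))) /=.
  apply: eq_bigr => nu _; rewrite comp_polyD comp_polyX comp_polyC add0r scale1r.
  by rewrite polyCD addrA.
by rewrite comp_polyA -sE -comp_polyA comp_aff !mul1r subrr aff10 comp_polyXr.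
Qed.

End Group.

(** A nonzero coefficient in degree i forces al^i = al^m, that is i = n mod l; as n < l, such i have
    the form n + l j. *)
Lemma scale_eigen_polyP (al : F) l n m s : (0 < l)%N -> (n < l)%N ->
    l.-primitive_root al -> (n = m %[mod l])%N ->
    s \Po (al *: 'X) = al ^+ m *: s ->
  exists s', s = 'X^n * (s' \Po 'X^l).
Proof.
move=> l0 ltnl pal nm sE.
have sP i : s`_i != 0 -> (i = n %[mod l])%N.
  move=> si; have := congr1 (fun p : {poly F} => p`_i) sE.
  rewrite coef_comp_scaleX coefZ mulrC => /(mulIf si)/eqP.
  by rewrite (eq_prim_root_expr pal) -nm => /eqP.
exists (\poly_(j < size s) s`_(n + l * j)).
apply/polyP => i; rewrite coefXnM; case: ltnP => [ltin | leni].
  apply/eqP; apply: contraTT ltin => /sP; rewrite (modn_small ltnl) => <-.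
  by rewrite -leqNgt leq_mod.
rewrite coef_comp_poly_Xn // coef_poly; case: ifP => [/dvdnP[j Ej] | ndvd].
  rewrite Ej mulnK // mulnC -Ej subnKC //; case: ltnP => // le_sj.
  rewrite nth_default // (leq_trans le_sj) // -(subnKC leni) Ej.
  by rewrite (leq_trans (leq_pmulr j l0)) // leq_addl.
apply/eqP; apply: contraFT ndvd => /sP/eqP.
by rewrite eqn_mod_dvd.
Qed.

End Invariants.

(** * Explicit descriptions of D_Z in the special cases *)

Section CenterCases.
Variables (F : fieldType) (h : {poly F}).
Implicit Types (r : {poly F}) (G : seq F).

Lemma enumG0 G : enumG h G -> 0 \in G.
Proof. by case=> _ GP; apply/GP/inP10. Qed.

Lemma enumGD G : enumG h G -> forall mu nu, mu \in G -> nu \in G -> mu + nu \in G.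
Proof.
case=> _ GP mu nu /GP Pmu /GP Pnu; apply/GP.
by have := inP_comp Pnu Pmu; rewrite !mul1r.
Qed.

(** Conjugating the translation by nu with z x + e gives the translation by z nu. *)
Lemma enumG_scale G z e : enumG h G -> inP h z e ->
  forall nu, nu \in G -> z * nu \in G.
Proof.
move=> [_ GP] Pze nu /GP Pnu; have [z0 _] := Pze; apply/GP.
have := inP_comp (inP_comp Pze Pnu) (inP_inv Pze); rewrite mulr1 mulfV //.
by rewrite mulrN mulrA mulfV // mul1r addrC addrK.
Qed.

Lemma inDZ_translationsP G r : (forall al be, inP h al be -> al = 1) ->
  enumG h G -> inDZ h r <-> exists s, r = s \Po \prod_(nu <- G) ('X + nu%:P).
Proof.
move=> P1 eG; have [Gu GP] := eG; rewrite -orbit_poly0.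
rewrite -(invariant_polyP Gu (enumG0 eG) (enumGD eG)).
split=> [rD nu /GP/rD -> | rG z e Pze]; first by rewrite expr1n scale1r.
by have z1 := P1 _ _ Pze; subst z; rewrite rG ?expr1n ?scale1r //; apply/GP.
Qed.

Lemma comp_XsubC_aff (z la : F) :
  ('X - la%:P) \Po aff z (la - z * la) = z *: ('X - la%:P).
Proof.
rewrite comp_polyB comp_polyX comp_polyC polyCB polyCM scalerBr -!mul_polyC.
by ring.
Qed.

(** In the coordinate centred at la the group P is all scalings, so r becomes a simultaneous
    eigenvector; over an infinite field this leaves one monomial. *)
Lemma inDZ_power_linearP (ga la : F) n r : ga != 0 -> (0 < n)%N ->
    h = ga *: ('X - la%:P) ^+ n -> (forall e : seq F, exists y, y \notin e) ->
  inDZ h r <-> exists c, r = c *: ('X - la%:P) ^+ n.-1.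
Proof.
move=> ga0 n0 hE Finf.
have sh : size h = n.+1 by rewrite hE size_scale // size_exp_XsubC.
have comp_pow z m :
    ('X - la%:P) ^+ m \Po aff z (la - z * la) = z ^+ m *: ('X - la%:P) ^+ m.
  by rewrite (rmorphXn (comp_poly (aff z (la - z * la)))) /= comp_XsubC_aff exprZn.
split=> [rD | [c ->] z e [z0 hz]]; last first.
  (* The only root of h is la, so evaluating at la shows that z x + e fixes it. *)
  have -> : e = la - z * la.
    have := congr1 (fun p => p.[la]) hz.
    rewrite hE horner_comp !hornerE /= subrr expr0n gtn_eqF // mulr0 => /eqP.
    rewrite mulf_eq0 (negPf ga0) expf_eq0 n0 /= subr_eq0 => /eqP E.
    by rewrite -[X in _ = X - _]E addrAC subrr add0r.
  by rewrite comp_polyZ comp_pow sh scalerA mulrC -scalerA.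
pose R := r \Po aff 1 la.
have RE z : z != 0 -> R \Po (z *: 'X) = z ^+ n.-1 *: R.
  move=> z0; have Pz : inP h z (la - z * la).
    by split; rewrite // {1}hE comp_polyZ comp_pow sh hE scalerA mulrC -scalerA.
  have := rD _ _ Pz; rewrite sh /R => /(congr1 (comp_poly (aff 1 la))).
  rewrite comp_polyZ => <-; rewrite -!comp_polyA comp_aff.
  rewrite comp_polyD comp_polyZ comp_polyX comp_polyC scale1r.
  by rewrite mulr1 [z * la + _]addrC subrK.
have Ri i : i != n.-1 -> R`_i = 0.
  move=> i_n; apply/eqP; apply/negPn/negP => Ri0.
  (* A nonroot x of this polynomial is a nonzero scalar with x^i different from x^(n-1), against the
     eigenvalue condition. *)
  have p0 : 'X * ('X^i - 'X^(n.-1)) != 0 :> {poly F}.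
    rewrite mulf_neq0 ?polyX_eq0 // subr_eq0; apply: contra i_n => /eqP E.
    by have := congr1 (fun p => size (polyseq p)) E; rewrite !size_polyXn => -[->].
  have [x] := infinite_nonroot Finf p0; rewrite !hornerE => x_nz.
  have x0 : x != 0 by apply: contraNneq x_nz => ->; rewrite mul0r.
  have := congr1 (fun p : {poly F} => p`_i) (RE _ x0).
  rewrite coef_comp_scaleX coefZ mulrC => /(mulIf Ri0) E.
  by case/negP: x_nz; rewrite E subrr mulr0.
have RX : R = R`_n.-1 *: 'X^(n.-1).
  apply/polyP => i; rewrite coefZ coefXn; have [-> | /Ri ->] := eqVneq i n.-1.
    by rewrite mulr1.
  by rewrite mulr0.
exists R`_n.-1; have -> : r = R \Po ('X - la%:P).
  rewrite /R -comp_polyA comp_polyD comp_polyZ comp_polyX comp_polyC scale1r.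
  by rewrite subrK comp_polyXr.
by rewrite {1}RX comp_polyZ comp_Xn_poly.
Qed.

Section Semidirect.
Variables (al be : F) (l : nat) (G : seq F).
Hypotheses (l_gt1 : (1 < l)%N) (pal : l.-primitive_root al) (Pab : inP h al be).
(** With [eG] this expresses the semidirect decomposition: multipliers are powers of al, and
    multiplier 1 means translation by an element of G. *)
Hypothesis Pcyc : forall z e, inP h z e -> exists k, z = al ^+ k.
Hypothesis eG : enumG h G.

Let la := be / (al - 1).

Lemma prim_root_neq1 : al - 1 != 0.
Proof.
rewrite subr_eq0; apply/eqP => al1; have := prim_order_dvd pal 1.
by rewrite expr1 al1 eqxx dvdn1 gtn_eqF.
Qed.

Lemma be_def : be = al * la - la.
Proof. by rewrite -{2}[la]mul1r -mulrBl mulrC /la divfK ?prim_root_neq1. Qed.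

(** These are the powers of al x + be, all fixing -la. *)
Lemma inP_fixed_point k : inP h (al ^+ k) (al ^+ k * la - la).
Proof.
elim: k => [|k IHk]; first by rewrite expr0 mul1r subrr; apply: inP10.
have := inP_comp Pab IHk; rewrite -exprS.
suff -> : al * (al ^+ k * la - la) + be = al ^+ k.+1 * la - la by [].
by rewrite be_def mulrBr mulrA -exprS addrA subrK.
Qed.

(** Some power of al x + be has the same multiplier z, so the two maps differ by a translation in
    G. *)
Lemma inP_translation z e : inP h z e -> e + la - z * la \in G.
Proof.
move=> Pze; have [k zE] := Pcyc Pze; have [z0 _] := Pze.
have Pfix := inP_fixed_point k; rewrite -zE in Pfix.
have := inP_comp Pze (inP_inv Pfix); rewrite mulfV // mulrN mulrA mulfV // mul1r.
move=> P1; apply/eG.2; congr (inP h 1 _): P1; ring.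
Qed.

Lemma orbit_poly_eigen z e : inP h z e ->
  orbit_poly G la \Po aff z e = z ^+ size G *: orbit_poly G la.
Proof.
move=> Pze; have [z0 _] := Pze; apply: orbit_poly_aff => //.
apply: perm_map_stable; last 1 first.
- move=> nu Gnu; apply: (enumG_scale eG (inP_inv Pze)).
  by apply: (enumGD eG) => //; apply: inP_translation.
- by move=> x y /(mulfI _)/addIr; apply; rewrite invr_eq0.
exact: eG.1.
Qed.

(* Multiplication by al permutes the nonzero elements of G, so al^(|G|-1) fixes
   their product. *)
Lemma card_G_mod : (size G = 1 %[mod l])%N.
Proof.
have Gu := eG.1; have G0 := enumG0 eG.
have al0 : al != 0 by have [] := Pab.
pose G' := rem 0 G; have sG' : size G' = (size G).-1 by rewrite size_rem.
have memG' nu : (nu \in G') = (nu != 0) && (nu \in G).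
  by rewrite mem_rem_uniq // inE.
have permG' : perm_eq [seq al * nu | nu <- G'] G'.
  apply: perm_map_stable; [exact: mulfI | exact: rem_uniq | ].
  move=> nu; rewrite !memG' mulf_eq0 negb_or al0 => /andP[-> /=].
  exact: enumG_scale eG Pab _.
have /eqP : \prod_(nu <- G') nu = al ^+ size G' * \prod_(nu <- G') nu.
  rewrite -{1}(perm_big _ permG') big_map big_split /=; congr (_ * _).
  by rewrite big_const_seq count_predT iter_mulr mulr1.
rewrite -subr_eq0 -{1}[\prod_(nu <- G') nu]mul1r -mulrBl mulf_eq0 orbC.
have /negPf -> : \prod_(nu <- G') nu != 0.
  by rewrite prodf_seq_neq0; apply/allP => nu; rewrite memG' => /andP[].
rewrite orFb subr_eq0 eq_sym -(prim_order_dvd pal) sG' => l_dvd.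
have G_gt0 : (0 < size G)%N by case: (G) G0.
by apply/eqP; rewrite eqn_mod_dvd // subn1.
Qed.

Lemma mul_card_G_mod n : (n * size G = n %[mod l])%N.
Proof. by rewrite -modnMmr card_G_mod modnMmr muln1. Qed.

(** Invariance under G gives r = s(T), and T(al x + be) = al^|G| T = al T, so the remaining
    condition becomes s(al x) = al^(deg h - 1) s. Conversely z^l = 1 makes T^l invariant, while T^n
    is scaled by z^(n |G|) = z^(deg h - 1). *)
Lemma inDZ_semidirectP n r : (n < l)%N -> (n * size G = (size h).-2 %[mod l])%N ->
  inDZ h r <-> exists s, r = orbit_poly G la ^+ n * (s \Po orbit_poly G la ^+ l).
Proof.
move=> ltnl nG; set T := orbit_poly G la.
have l_gt0 : (0 < l)%N by apply: ltnW.
split=> [rD | [s ->] z e Pze]; last first.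
  have [k zE] := Pcyc Pze.
  have zl : z ^+ l = 1 by rewrite zE exprAC (prim_expr_order pal) expr1n.
  rewrite comp_polyM -comp_polyA.
  rewrite !(rmorphXn (comp_poly (aff z e))) /= orbit_poly_eigen // -/T !exprZn.
  rewrite -!exprM [(size G * l)%N]mulnC [z ^+ (l * _)]exprM zl.
  rewrite expr1n scale1r -scalerAl.
  by rewrite -(expr_mod (size G * n) zl) mulnC nG (expr_mod _ zl).
have [|s sE] := (invariant_poly_shiftP eG.1 (enumG0 eG) (enumGD eG) la r).1.
  by move=> nu /eG.2/rD ->; rewrite expr1n scale1r.
have sT : (1 < size T)%N by rewrite size_orbit_poly; case: (G) (enumG0 eG).
have [||s' s'E] := @scale_eigen_polyP F al l n (size h).-2 s l_gt0 ltnl pal.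
- by rewrite -nG mul_card_G_mod.
(* T is nonconstant, so the eigenvalue equation for s may be checked after composing with T. *)
- apply: (comp_poly_inj sT); rewrite /= [RHS]comp_polyZ -sE.
  rewrite -(rD _ _ Pab) sE.
  rewrite -!comp_polyA orbit_poly_eigen // -/T comp_polyZ comp_polyX.
  by rewrite -(prim_expr_mod pal) card_G_mod (prim_expr_mod pal) expr1.
by exists s'; rewrite sE -/T s'E comp_polyM comp_Xn_poly -comp_polyA comp_Xn_poly.
Qed.

End Semidirect.

End CenterCases.

Unset Implicit Arguments.

Theorem theorem8p12 (F : fieldType) (h : {poly F}) (hdeg : (1 < size h)%N) :
  (* Z(A) = { phi_r : r in D_Z } *)
  (forall s, is_central_aut h s <-> exists r, inDZ h r /\ s =1 phi h r)
  (* (1) *)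
  /\ ((forall s, is_aut h s -> exists f, s =1 phi h f) ->
        (forall r, inDZ h r) /\ (forall s, is_aut h s -> is_central_aut h s))
  (* (2) *)
  /\ ((forall al be, inP h al be -> al = 1) ->
        forall sG, enumG h sG ->
        forall r, inDZ h r <->
          exists s : {poly F}, r = s \Po (\prod_(nu <- sG) ('X + nu%:P)))
  (* (3) *)
  /\ (forall (ga la : F) (n : nat), ga != 0 -> (1 <= n)%N ->
        h = ga *: ('X - la%:P) ^+ n ->
        (forall s : seq F, exists y, y \notin s) ->
        forall r, inDZ h r <-> exists c : F, r = c *: ('X - la%:P) ^+ n.-1)
  (* (4) *)
  /\ (forall (al be : F) (l : nat), (1 < l)%N -> l.-primitive_root al ->
        inP h al be ->
        (forall z e, inP h z e -> exists k, z = al ^+ k) ->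
        forall sG, enumG h sG ->
        (exists n, (n < l)%N /\ (n * size sG = (size h).-2 %[mod l])%N)
        /\ forall n, (n < l)%N -> (n * size sG = (size h).-2 %[mod l])%N ->
           forall r, inDZ h r <->
             exists s : {poly F},
               r = (\prod_(nu <- sG) ('X + (be / (al - 1) + nu)%:P) ^+ n)
                   * (s \Po (\prod_(nu <- sG) ('X + (be / (al - 1) + nu)%:P) ^+ l)))
  (* in all cases phi_r is central for r in F h' *)
  /\ (forall c : F, is_central_aut h (phi h (c *: h^`()))).
Proof.
split; first exact: is_central_autP.
split.
  move=> allphi; have rD r : inDZ h r.
    (* If tau_{z,e} is some phi_f, it fixes x, hence z = 1 and e = 0, and the condition on r is
       trivial. *)
    move=> z e Pze; have [f fE] := allphi _ (is_aut_Ah_aut hdeg 0 Pze).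
    have := fE 'X%:P; rewrite phiE !Ah_autC !comp_polyX aff10 => /polyC_inj E.
    have := congr1 (coefp 0) E; have := congr1 (coefp 1) E => /=.
    rewrite !(coefD, coefZ, coefX, coefC) /= mulr1 mulr0 addr0 add0r => z1 e0.
    by subst z e; rewrite comp_poly_aff10 expr1n scale1r.
  split=> // s /allphi[f fE]; apply/(is_central_autP hdeg).
  by exists f.
split; first by move=> P1 G eG r; apply: inDZ_translationsP.
split; first by move=> ga la n ga0 n0 hE Finf r; apply: inDZ_power_linearP hE Finf.
split; last first.
  move=> c; apply/(is_central_autP hdeg); exists (c *: h^`()).
  by split=> //; apply: inDZ_deriv.
move=> al be l l1 pal Pab Pcyc G eG; split.
  (* Since |G| = 1 mod l, the residue of deg h - 1 itself solves the congruence. *)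
  exists ((size h).-2 %% l)%N; split; first by rewrite ltn_mod ltnW.
  by rewrite (mul_card_G_mod pal Pab eG) modn_mod.
move=> n ltnl nG r; rewrite !prodrXl -/(orbit_poly G _).
exact: (inDZ_semidirectP l1 pal Pab Pcyc eG).
Qed.
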